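(* For every $k\ge 1$, the Narayana polynomial $N_k(t)=\sum_{m=1}^{k}N_{k,m}t^m$, where $N_{k,m}=\frac{1}{k}\binom{k}{m}\binom{k}{m-1}$, is $\gamma$-positive, with expansion $$N_k(t)=\sum_{j=1}^{\lfloor (k+1)/2\rfloor}\gamma^N_{k,j}\,t^j(1+t)^{k+1-2j},$$ where $$\gamma^N_{k,j}=\left|\{c\in\mathsf{DComp}_{k,j}:\mathsf{Dnu}(c)=\varnothing\}\right|=\left|\{c\in\mathsf{DComp}_{k,k-j+1}:\mathsf{Do}(c)=\varnothing\}\right|.$$
   Context: For a sequence $c=(c_1,\ldots,c_l)$ of positive integers and $i\le j$, $f(c;i,j)=\sum_{t=i}^{j}(c_t-2)$. A composition $c=(c_1,\ldots,c_l)$ is dominating if $f(c;1,i)>0$ for all $1\le i\le l$. $\mathsf{DComp}_{k,m}$ denotes the set of dominating compositions of $2k+1$ into exactly $k$ parts having exactly $m$ parts larger than $1$. For $c\in\mathsf{DComp}_{k,m}$ set $c_{k+1}:=1$; $\mathsf{Dnu}(c)$ is the set of parts $c_i$ ($1\le i\le k$) with $c_i>1$ and $c_{i+1}>1$, and $\mathsf{Do}(c)$ is the set of parts $c_i$ ($1\le i\le k$) with $c_i=1$ and $c_{i+1}=1$. *)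

(* Defs.v *)
From HB Require Import structures.
From mathcomp Require Import all_boot all_order all_algebra.

Set Implicit Arguments.
Unset Strict Implicit.
Unset Printing Implicit Defensive.

Import Order.TTheory GRing.Theory Num.Theory.
Local Open Scope ring_scope.

(* c_t, with t counted from 1. The default value 1 of nth yields the
   convention c_(l+1) := 1 for c = (c_1, ..., c_l). *)
Definition part (c : seq nat) (t : nat) : nat := nth 1%N c t.-1.

Definition fpart (c : seq nat) (i j : nat) : int :=
  \sum_(i <= t < j.+1) ((part c t)%:Z - 2).

Definition is_composition (n : nat) (c : seq nat) : bool :=
  all (fun x => 0 < x)%N c && (sumn c == n).

Definition dominating (c : seq nat) : bool :=
  all (fun i => 0 < fpart c 1 i) (iota 1 (size c)).

Definition is_dcomp (k m : nat) (c : seq nat) : bool :=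
  [&& is_composition (2 * k + 1) c, size c == k, dominating c
    & count (fun x => 1 < x)%N c == m].

Definition parts (k n : nat) (c : k.-tuple 'I_n) : seq nat :=
  [seq nat_of_ord x | x <- c].

(* Parts of a composition of 2k+1 are at most 2k+1, so restricting them to
   'I_(2k+2) loses nothing (see DComp_complete) and makes the set finite. *)
Definition DComp (k m : nat) : {set k.-tuple 'I_(2 * k + 2)} :=
  [set c : k.-tuple 'I_(2 * k + 2) | is_dcomp k m (parts c)].

Lemma DComp_complete (k m : nat) (c : seq nat) :
  is_dcomp k m c -> exists2 d, d \in DComp k m & parts d = c.
Proof.
move=> dc; have /and4P[/andP[_ /eqP sc] /eqP kc _ _] := dc.
have lec x : x \in c -> (x < 2 * k + 2)%N.
  move=> xc; rewrite addn2 ltnS -addn1 -sc sumnE (big_rem x) //=.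
  exact: leq_addr.
have [s sE] : exists s : seq 'I_(2 * k + 2), [seq nat_of_ord x | x <- s] = c.
  elim: c lec {dc sc kc} => [|a c IH] lec; first by exists [::].
  have [x xc|s sE] := IH; first by apply: lec; rewrite inE xc orbT.
  by exists (Ordinal (lec a (mem_head _ _)) :: s); rewrite /= sE.
have ss : size s == k by rewrite -(size_map (@nat_of_ord _)) sE kc.
by exists (Tuple ss); rewrite ?inE /parts /= sE.
Qed.

(* A part is identified with its position, so that equal parts at different
   places stay distinct; the ordinal i stands for position i+1. *)
Definition Dnu (c : seq nat) : {set 'I_(size c)} :=
  [set i : 'I_(size c) | (1 < part c i.+1)%N && (1 < part c i.+2)%N].

Definition Do (c : seq nat) : {set 'I_(size c)} :=
  [set i : 'I_(size c) | (part c i.+1 == 1%N) && (part c i.+2 == 1%N)].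

Definition narayana (k m : nat) : rat :=
  k%:R^-1 * 'C(k, m)%:R * 'C(k, m.-1)%:R.

Definition narayana_poly (k : nat) : {poly rat} :=
  \sum_(1 <= m < k.+1) narayana k m *: 'X^m.

(* n/2 is the centre of symmetry of p. *)
Definition gamma_positive (R : numDomainType) (p : {poly R}) : Prop :=
  exists (n : nat) (g : nat -> R), (forall i, 0 <= g i) /\
    p = \sum_(0 <= i < (n %/ 2).+1) g i *: ('X^i * (1 + 'X) ^+ (n - 2 * i)).

(* Main.v *)
Require Import Defs.
From mathcomp Require Import all_boot all_order all_algebra.
From mathcomp Require Import zify ring.

(** Reading a composition as a walk with steps [c_t - 2], followed by the extra
    part [c_(k+1) = 1], a dominating composition of [2k+1] into [k] parts is an
    excursion that returns to height 0 for the first time at its last step.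
    The walks from an arbitrary height [h] down to 0 which avoid two adjacent
    large parts (resp. two adjacent ones) have ballot-like closed forms.  Peeling
    off the first part gives a sum over all its values, and taking the difference
    of this recurrence at [h] and [h+1] leaves an identity between products of
    two binomials, which follows from Pascal's rule.  An excursion starts with a
    part at least 3; decreasing this part by 1 gives a walk from height 1, where
    both closed forms equal [1/j * C(k-j, j-1) * C(k-1, j-1)].  Finally
    [1/j * C(k-j, j-1) * C(k-1, j-1) * C(k+1-2j, m-j)] is
    [1/k * C(k, m-1) * C(k-m+1, j) * C(m-1, m-j)], whose sum over [j] is
    evaluated by Vandermonde's identity. *)

Import Order.TTheory GRing.Theory Num.Theory.
Local Open Scope ring_scope.

(** * Compositions as walks *)

(** The word ends at height 1, from where the appended part 1 leads to 0; [2 < h + x] keeps the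
    height positive before that. *)
Fixpoint walk (h : nat) (c : seq nat) : bool :=
  if c is x :: c' then [&& (0 < x)%N, (2 < h + x)%N & walk (h + x - 2) c']
  else h == 1%N.

Lemma fpart_cons x c i : fpart (x :: c) 1 i.+1 = x%:Z - 2 + fpart c 1 i.
Proof.
rewrite /fpart big_ltn // /part /=; congr (_ + _).
by rewrite big_add1 [RHS]big_nat_cond big_nat_cond; apply: eq_bigr => -[|t].
Qed.

Lemma walkE h c :
  walk h c = [&& all (fun x => 0 < x)%N c, (h + sumn c == 2 * size c + 1)%N
               & all (fun i => 0 < h%:Z + fpart c 1 i) (iota 1 (size c))].
Proof.
elim: c h => [|x c IH] h /=; first by rewrite !andbT; lia.
have -> : iota 2 (size c) = [seq i.+1 | i <- iota 1 (size c)].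
  by rewrite -(iotaDl 1 1).
rewrite all_map fpart_cons {1}/fpart big_geq // addr0 IH.
have [x0|] := boolP (0 < x)%N => //=.
have [hx|hx] := boolP (2 < h + x)%N; last first.
  by symmetry; apply/negbTE/and3P => -[_ _ /andP[]]; lia.
have -> : (0 < h%:Z + (x%:Z - 2)) by lia.
rewrite andTb (_ : (h + x - 2 + sumn c == 2 * size c + 1)%N =
  (h + (x + sumn c) == 2 * (size c).+1 + 1)%N); last by lia.
do 2!congr (_ && _).
by apply: eq_all => i /=; rewrite fpart_cons; lia.
Qed.

Lemma is_dcompE k m c :
  is_dcomp k m c =
    [&& size c == k, walk 0 c & count (fun x => 1 < x)%N c == m].
Proof.
rewrite /is_dcomp /is_composition /dominating walkE add0n.
have [<-|] := eqVneq (size c) k; last by rewrite andbF.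
rewrite /= -!andbA; congr [&& _, _ & _ && _].
by apply: eq_all => i; rewrite add0r.
Qed.

(** The default 1 of [nth] agrees with the last letter of [rcons c 1], so the pairs tested are its
    consecutive letters. *)
Lemma adjacent_set0 (e : rel nat) c :
  ([set i : 'I_(size c) | e (part c i.+1) (part c i.+2)] == set0) =
  sorted (fun x y => ~~ e x y) (rcons c 1%N).
Proof.
have nthE i : nth 1%N (rcons c 1%N) i = nth 1%N c i.
  rewrite nth_rcons; case: ltngtP => // h; last by rewrite h nth_default.
  by rewrite nth_default // ltnW.
apply/eqP/(sortedP 1%N) => [H i|H].
  rewrite size_rcons ltnS => ic; rewrite !nthE.
  by have /setP/(_ (Ordinal ic)) := H; rewrite !inE /part /= => ->.
apply/setP => i; rewrite !inE /part /=; apply/negbTE.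
by rewrite -!nthE; apply: H; rewrite size_rcons ltnS.
Qed.

(** * Counting words by their first letter *)

Definition nword (n k : nat) (P : pred (seq nat)) : nat :=
  #|[set c : k.-tuple 'I_n | P (parts c)]|.

Lemma eq_nword n k P Q : P =1 Q -> nword n k P = nword n k Q.
Proof. by move=> PQ; apply: eq_card => c; rewrite !inE PQ. Qed.

Lemma nword_pred0 n k P : P =1 xpred0 -> nword n k P = 0%N.
Proof. by move=> P0; apply: eq_card0 => c; rewrite inE P0. Qed.

Lemma nword0 n P : nword n 0 P = P [::].
Proof.
rewrite /nword; case: (boolP (P [::])) => P0.
  transitivity #|{: 0.-tuple 'I_n}|; last by rewrite card_tuple.
  by apply: eq_card => c; rewrite !inE tuple0.
by apply: eq_card0 => c; rewrite inE tuple0; apply: negbTE.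
Qed.

Lemma nwordS n k P :
  nword n k.+1 P = (\sum_(x < n) nword n k (fun c => P (nat_of_ord x :: c)))%N.
Proof.
rewrite /nword -sum1_card.
pose f (p : 'I_n * k.-tuple 'I_n) := [tuple of p.1 :: p.2].
have fb : bijective f.
  exists (fun t => (thead t, [tuple of behead t])) => [[x t]|t].
    by rewrite /f; congr pair; apply: val_inj.
  by rewrite /f -tuple_eta.
rewrite (reindex f) /=; last exact: onW_bij.
rewrite (eq_bigl (fun p => xpredT p.1 && (P (parts (f p)))));
  last by move=> p; rewrite inE.
rewrite -(pair_big_dep xpredT (fun x t => P (parts (f (x, t)))) (fun _ _ => 1%N)) /=.
apply: eq_bigr => x _; rewrite -sum1_card; apply: eq_bigl => t.
by rewrite inE.
Qed.

Lemma nwordSS n k P :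
  nword n.+2 k.+1 P =
  (nword n.+2 k (fun c => P (0 :: c)) + (nword n.+2 k (fun c => P (1 :: c))
   + \sum_(0 <= v < n) nword n.+2 k (fun c => P (v.+2 :: c))))%N.
Proof. by rewrite nwordS !big_ord_recl /= big_mkord. Qed.

(* [p] is the part that precedes the word [c], and the [1] appended to [c]
   stands for the part c_(k+1). *)
Definition walks (e : rel nat) (a : pred nat) (p h j : nat) : pred (seq nat) :=
  fun c => [&& walk h c, path e p (rcons c 1%N) & count a c == j].

(** The summands belong to the first parts 1 and [v.+2]; [walk] rejects a part 0. The tests
    [a _ <= j] guard the truncated subtractions. *)
Lemma nword_walksS e a n k p h j :
  nword n.+2 k.+1 (walks e a p h j) =
  (nword n.+2 k (fun c => [&& 1 < h, e p 1, walks e a 1 h.-1 (j - a 1) c & a 1 <= j])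
   + \sum_(0 <= v < n) nword n.+2 k (fun c =>
       [&& 0 < h + v, e p v.+2, walks e a v.+2 (h + v) (j - a v.+2) c & a v.+2 <= j]))%N.
Proof.
rewrite nwordSS nword_pred0 // add0n; congr (_ + _)%N; last first.
  apply: eq_bigr => v _; apply: eq_nword => c; rewrite /walks /=.
  rewrite (_ : h + v.+2 - 2 = h + v)%N; last by lia.
  rewrite (_ : (2 < h + v.+2) = (0 < h + v))%N; last by lia.
  case: (0 < h + v)%N => //=; case: (e p v.+2); rewrite /= ?andbF //.
  by rewrite -!andbA; congr [&& _, _ & _]; case: (a v.+2); lia.
apply: eq_nword => c; rewrite /walks /=.
rewrite (_ : h + 1 - 2 = h.-1)%N; last by lia.
rewrite (_ : (2 < h + 1) = (1 < h))%N; last by lia.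
case: (1 < h)%N => //=; case: (e p 1); rewrite /= ?andbF //.
by rewrite -!andbA; congr [&& _, _ & _]; case: (a 1%N); lia.
Qed.

(* Number of walks of length [L] from height [h] that reach 0 only at the end,
   with [j] large parts and no two adjacent large parts:
   h/j * C(L-j-1, j-1) * C(L-1-h, j-1) for j > 0. The case distinctions avoid
   truncated subtractions. *)
Definition nu_count (L h j : nat) : rat :=
  match j, L with
  | 0, _ => (L == h)%:R
  | i.+1, M.+2 =>
      if (h <= M.+1)%N then
        h%:R / i.+1%:R * 'C(M - i, i)%:R * 'C(M.+1 - h, i)%:R
      else 0
  | _, _ => 0
  end.

(* The same for walks that start with a large part, contain [j] ones and no two
   adjacent ones: h/j * C(L-j-1, j-1) * C(L-1-h, j-h). *)
Definition o_count (L h j : nat) : rat :=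
  match j, L with
  | 0, _ => ((L == 0%N) && (h == 0%N))%:R
  | i.+1, M.+2 =>
      if (h <= i.+1)%N then
        h%:R / i.+1%:R * 'C(M - i, i)%:R * 'C(M.+1 - h, i.+1 - h)%:R
      else 0
  | _, _ => 0
  end.

(** * Recurrences for the closed forms *)

(** Turns neighbouring binomials into rational multiples of one another, so that [field] can settle
    the recurrences. *)
Lemma natr_binS n m :
  'C(n, m.+1)%:R = (n%:R - m%:R) / m.+1%:R * 'C(n, m)%:R :> rat.
Proof.
have m1 : m.+1%:R != 0 :> rat by rewrite pnatr_eq0.
apply: (mulfI m1); rewrite mulrA mulrCA mulfV // mulr1.
have [mn|nm] := leqP m n; first by rewrite -natrB // -!natrM mul_bin_left.
by rewrite !bin_small ?mulr0 // ltnW.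
Qed.

Lemma nu_count_ge L h j : (L <= h)%N -> nu_count L h j.+1 = 0.
Proof. by case: L => [|[|M]] //= Lh; rewrite leqNgt Lh. Qed.

Lemma nu_countS0 L j : nu_count L.+1 0 j = 0.
Proof. by case: j L => [|i] [|L] //=; rewrite !mul0r. Qed.

(** The left side is D(h) - D(h+1), where D(h) is the right side of [sum_nu_count]; hence that sum
    telescopes. *)
Lemma nu_count_rec k h j :
  nu_count k.+2 h.+1 j.+1 - nu_count k.+1 h j.+1
  - (nu_count k.+2 h.+2 j.+1 - nu_count k.+1 h.+1 j.+1) = nu_count k h j.
Proof.
case: j => [|i].
  rewrite /nu_count !bin0 !divr1.
  case: k => [|k]; first by case: h => [|h] //; rewrite /= !subr0.
  rewrite !ltnS !bin0 !mulr1 eq_sym.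
  by case: (ltngtP h k.+1); case: (leqP h k) => //= *; rewrite -?natr1;
    solve [ring | lia].
case: k => [|[|M]].
- by rewrite /nu_count bin0n !mulr0 ?mul0r ?if_same ?subr0.
- by rewrite /nu_count subSS bin0n !mulr0 ?mul0r ?if_same ?subr0.
rewrite /nu_count !ltnS !subSS.
have [iM|Mi] := ltnP M i.
  rewrite (_ : M.+1 - i = 0)%N 1?(_ : M - i = 0)%N; try lia.
  by rewrite !bin0n (_ : (i == 0%N) = false) ?mulr0 ?mul0r ?if_same ?subr0; [|lia].
have [hM|Mh] := leqP h M.+1; last first.
  case: ifP => // hM.
  by rewrite (_ : M.+2 - h = 0)%N ?bin0n ?mulr0 ?subr0 //; lia.
(* Every term becomes a rational multiple of ['C(M - i, i) * 'C(M.+1 - h, i)]. *)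
rewrite leqW // subSn // subSn // !binS !natrD.
rewrite !natr_binS !natrB // -!natr1.
have i1 : i%:R + 1 != 0 :> rat by rewrite natr1 pnatr_eq0.
have i2 : i%:R + 1 + 1 != 0 :> rat by rewrite !natr1 pnatr_eq0.
by field; rewrite i1 i2.
Qed.

Lemma sum_nu_count n k h j : (k < n)%N ->
  \sum_(0 <= v < n) nu_count k (h + v) j =
  nu_count k.+2 h.+1 j.+1 - nu_count k.+1 h j.+1.
Proof.
move=> kn.
pose f v := nu_count k.+1 (h + v) j.+1 - nu_count k.+2 (h + v).+1 j.+1.
rewrite (eq_bigr (fun v => f v.+1 - f v)); last first.
  by move=> v _; rewrite -nu_count_rec /f addnS; ring.
(* Since [k < n], the heights at the upper end are at least the lengths, so these terms vanish. *)
rewrite telescope_sumr // /f addn0 (@nu_count_ge _ (h + n)); last by lia.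
rewrite (@nu_count_ge _ (h + n).+1); last by lia.
by rewrite subrr sub0r opprB.
Qed.

Lemma o_count_ge L h j : (0 < L)%N -> (L <= h)%N -> o_count L h j = 0.
Proof.
case: j L => [|i] [|[|M]] //= _ Mh; case: leqP => // hi.
have -> : (M - i = 0)%N by lia.
by case: i hi => [|i] hi; [lia | rewrite bin0n mulr0 mul0r].
Qed.

Lemma o_countS0 L j : o_count L.+1 0 j = 0.
Proof. by case: j L => [|i] [|L] //=; rewrite !mul0r. Qed.

Lemma o_count_rec k h j :
  o_count k.+2 h.+1 j.+1 - o_count k.+2 h.+2 j.+1 =
  o_count k.+1 h.+1 j.+1 + o_count k h j.
Proof.
case: j => [|i].
  rewrite /o_count !bin0 !divr1.
  by case: h => [|h]; case: k => [|k]; rewrite ?andbF ?bin0 ?mulr1.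
case: k => [|[|M]].
- by rewrite /o_count bin0n !mulr0 ?mul0r ?if_same ?subr0 ?addr0.
- by rewrite /o_count subSS bin0n !mulr0 ?mul0r ?if_same ?subr0 ?addr0.
rewrite /o_count !ltnS !subSS.
have [iM|Mi] := ltnP M i.
  rewrite (_ : M.+1 - i = 0)%N 1?(_ : M - i = 0)%N; try lia.
  by rewrite !bin0n (_ : (i == 0%N) = false) ?mulr0 ?mul0r ?if_same ?subr0 ?addr0; [|lia].
have i1 : i%:R + 1 != 0 :> rat by rewrite natr1 pnatr_eq0.
have i2 : i%:R + 1 + 1 != 0 :> rat by rewrite !natr1 pnatr_eq0.
have [hi|ih|->] := ltngtP h i.+1.
- rewrite (_ : h <= i)%N // (_ : M.+2 - h = (M.+1 - h).+1)%N; last by lia.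
  rewrite (_ : i.+1 - h = (i - h).+1)%N; last by lia.
  rewrite subSn // !binS !natrD !natr_binS !natrB //; try lia.
  have i3 : i%:R - h%:R + 1 != 0 :> rat.
    by rewrite -natrB // natr1 pnatr_eq0.
  by rewrite -!natr1 !natrB // -?natr1; field; rewrite i1 i2 i3.
- by case: leqP => [|_]; [lia | rewrite subrr].
(* Boundary case h = i+1: the term at height h+2 is 0, and the remaining second binomials have lower
   index 0. *)
- rewrite ltnn !subnn !bin0 subr0 !mulr1 subSn // binS natrD natr_binS.
  rewrite natrB // -!natr1.
  by field; rewrite i1 i2.
Qed.

Lemma sum_o_count n k h j : (k < n)%N ->
  \sum_(0 <= v < n) (o_count k.+1 (h + v).+1 j.+1 + o_count k (h + v) j) =
  o_count k.+2 h.+1 j.+1.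
Proof.
move=> kn; pose f v := - o_count k.+2 (h + v).+1 j.+1.
rewrite (eq_bigr (fun v => f v.+1 - f v)); last first.
  by move=> v _; rewrite -o_count_rec /f addnS opprK addrC.
rewrite telescope_sumr // /f addn0 o_count_ge ?opprK ?oppr0 ?add0r //; lia.
Qed.

Lemma nu_count1 k j : nu_count k.+2 1 j.+1 = o_count k.+2 1 j.+1.
Proof. by rewrite /nu_count /o_count !subSS !subn0. Qed.

(** * Gamma expansion of the Narayana polynomial *)

(** Both sides count pairs of disjoint subsets of sizes a and b in an n-set. *)
Lemma mul_binD n a b :
  ('C(n, a) * 'C(n - a, b) = 'C(n, a + b) * 'C(a + b, a))%N.
Proof.
have [abn|nab] := leqP (a + b) n; last first.
  rewrite (@bin_small n (a + b)) // mul0n.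
  have [an|na] := leqP a n; last by rewrite bin_small.
  by rewrite [X in (_ * X)%N]bin_small ?muln0; lia.
have f0 : (0 < a`! * b`! * (n - (a + b))`!)%N by rewrite !muln_gt0 !fact_gt0.
apply/eqP; rewrite -(eqn_pmul2r f0); apply/eqP; transitivity n`!.
  rewrite -(@bin_fact n a) ?(leq_trans (leq_addr b a)) //.
  by rewrite -(@bin_fact (n - a) b) ?subnDA; [ring|lia].
rewrite -(@bin_fact n (a + b)) // -(@bin_fact (a + b) a) ?leq_addr // addKn.
by ring.
Qed.

Lemma mul_bin_swap n a b :
  ('C(n, a) * 'C(n - a, b) = 'C(n, b) * 'C(n - b, a))%N.
Proof. by rewrite !mul_binD addnC -(@bin_sub (b + a) a) ?leq_addl // addnK. Qed.

Lemma coef_1DXn (R : comNzRingType) n i : ((1 + 'X) ^+ n : {poly R})`_i = 'C(n, i)%:R.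
Proof.
rewrite addrC; elim: n i => [|n IH] i; first by rewrite expr0 coef1 bin0n.
rewrite exprSr mulrDr mulr1 coefD coefMX !IH.
by case: i => [|i] /=; rewrite ?bin0 ?add0r // binS natrD addrC.
Qed.

(** For j >= 1 and 2j <= k+1 this is C(k-1, 2j-2) times the Catalan number of index j-1. *)
Definition narayana_gamma (k j : nat) : rat :=
  j%:R^-1 * 'C(k - j, j.-1)%:R * 'C(k.-1, j.-1)%:R.

Lemma sum_narayana_gamma k m : (0 < k)%N ->
  narayana k m.+1 = \sum_(0 <= i < (k + 1) %/ 2)
     narayana_gamma k i.+1
       * (if (i <= m)%N then 'C(k + 1 - 2 * i.+1, m - i) else 0)%:R.
Proof.
move=> k0; have kN0 : k%:R != 0 :> rat by rewrite pnatr_eq0 -lt0n.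
have termE i : (i <= m)%N ->
    narayana_gamma k i.+1 * 'C(k + 1 - 2 * i.+1, m - i)%:R =
    k%:R^-1 * 'C(k, m)%:R * ('C(k - m, i.+1) * 'C(m, m - i))%:R.
  move=> im; rewrite /narayana_gamma /=.
  have i0 : i.+1%:R != 0 :> rat by rewrite pnatr_eq0.
  have E1 : k%:R * 'C(k.-1, i)%:R = i.+1%:R * 'C(k, i.+1)%:R :> rat.
    by rewrite -!natrM mul_bin_diag.
  have E2 : 'C(k - i.+1, i)%:R * 'C(k + 1 - 2 * i.+1, m - i)%:R =
             'C(k - i.+1, m)%:R * 'C(m, m - i)%:R :> rat.
    have -> : (k + 1 - 2 * i.+1 = k - i.+1 - i)%N by lia.
    by rewrite -!natrM mul_binD subnKC // bin_sub.
  have E3 : 'C(k, i.+1)%:R * 'C(k - i.+1, m)%:R =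
            'C(k, m)%:R * 'C(k - m, i.+1)%:R :> rat.
    by rewrite -!natrM mul_bin_swap.
  have -> : 'C(k.-1, i)%:R = i.+1%:R * 'C(k, i.+1)%:R / k%:R :> rat.
    by rewrite -E1 mulrAC mulfV // mul1r.
  rewrite natrM [RHS]mulrA -(mulrA _ 'C(k, m)%:R) -E3 -!mulrA -E2.
  by move: (i.+1%:R) i0 => x x0; field; rewrite x0 kN0.
transitivity (k%:R^-1 * 'C(k, m)%:R *
    \sum_(0 <= i < m.+1) ('C(k - m, i.+1) * 'C(m, m - i))%:R : rat).
  rewrite /narayana /= mulrAC; congr (_ * _).
  rewrite -natr_sum; congr (_%:R); have [mk|km] := leqP m k; last first.
    rewrite bin_small; last exact: ltnW.
    symmetry; apply: big1 => i _.
    by rewrite (_ : k - m = 0)%N ?mul0n; lia.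
  (* Vandermonde for k = (k-m) + m at m+1; its term of index 0 is C(m, m+1) = 0, hence the shift to
     [i.+1]. *)
  rewrite -[in LHS](subnK mk) -binomial.Vandermonde big_ord_recl bin0 mul1n subn0.
  by rewrite (@bin_small m m.+1) // add0n big_mkord.
rewrite big_distrr /=.
pose F i := narayana_gamma k i.+1
       * (if (i <= m)%N then 'C(k + 1 - 2 * i.+1, m - i) else 0)%:R.
have F0 i : ((k + 1) %/ 2 <= i)%N -> F i = 0.
  move=> ki; rewrite /F /narayana_gamma (@bin_small (k - i.+1)) ?mulr0 ?mul0r //=.
  by lia.
have F0' i : (m < i)%N -> F i = 0 by move=> mi; rewrite /F leqNgt mi mulr0.
(* [F] vanishes beyond either range of summation, so both sums extend to the larger one. *)
pose n := maxn m.+1 ((k + 1) %/ 2).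
transitivity (\sum_(0 <= i < n) F i).
  rewrite [RHS](big_cat_nat (n := m.+1)) ?leq_maxl //= [X in _ + X]big_nat_cond.
  rewrite [X in _ + X]big1 ?addr0; last by move=> i /andP[/andP[mi _] _]; apply: F0'.
  rewrite !big_mkord; apply: eq_bigr => i _; rewrite /F -ltnS ltn_ord termE //.
  by rewrite -ltnS.
rewrite (big_cat_nat (n := (k + 1) %/ 2)) ?leq_maxr //= [X in _ + X]big_nat_cond.
by rewrite [X in _ + X]big1 ?addr0 // => i /andP[/andP[ki _] _]; apply: F0.
Qed.

Lemma narayana_poly_gamma k : (0 < k)%N ->
  narayana_poly k = \sum_(1 <= j < ((k + 1) %/ 2).+1)
    narayana_gamma k j *: ('X^j * (1 + 'X) ^+ (k + 1 - 2 * j)).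
Proof.
move=> k0; apply/polyP => m; rewrite /narayana_poly !big_add1 /= !coef_sum.
under eq_bigr do rewrite coefZ coefXn.
under [RHS]eq_bigr do rewrite coefZ coefXnM.
case: m => [|m].
  by rewrite !big1 // => i _; rewrite ?mulr0.
under [RHS]eq_bigr do rewrite ltnS subSS coef_1DXn.
transitivity (narayana k m.+1); last first.
  rewrite sum_narayana_gamma //; apply: eq_bigr => i _.
  by rewrite ltnNge; case: leqP.
have [mk|km] := ltnP m k.
  rewrite big_mkord (bigD1 (Ordinal mk)) //= eqxx mulr1 big1 ?addr0 // => i.
  by rewrite -val_eqE /= eqSS eq_sym => /negbTE ->; rewrite mulr0.
rewrite /narayana (@bin_small k) // mulr0 mul0r big_nat_cond big1 // => i.
by move=> /andP[/andP[_ ik] _]; rewrite eqSS (gtn_eqF (leq_trans ik km)) mulr0.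
Qed.

(** * Counting restricted walks *)

Definition large (x : nat) : bool := (1 < x)%N.
Definition nu_free : rel nat := fun x y => ~~ ((1 < x) && (1 < y))%N.
Definition o_free : rel nat := fun x y => ~~ ((x == 1) && (y == 1))%N.

Lemma walks_prev (e : rel nat) a p q h j c : e p =1 e q ->
  walks e a p h j c = walks e a q h j c.
Proof. by move=> epq; case: c => [|x c]; rewrite /walks /= epq. Qed.

(** A preceding 1 forbids nothing, while a preceding large part forces a 1, which lowers both height
    and length by one. Lengths include the appended 1, and [k <= n] leaves room for every possible
    part. *)
Lemma nword_nu n k h j : (k <= n)%N ->
  (nword n.+2 k (walks nu_free large 1 h.+1 j))%:R = nu_count k.+1 h.+1 j
  /\ (nword n.+2 k (walks nu_free large 2 h.+1 j))%:R = nu_count k h j.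
Proof.
elim: k h j => [|k IH] h j kn.
  rewrite !nword0 /walks /=; case: j => [|j]; rewrite ?andbF //=.
  by rewrite /= eqSS eq_sym andbT.
have e1 p : (nword n.+2 k (fun c => [&& (1 < h.+1)%N, nu_free p 1,
      walks nu_free large 1 h.+1.-1 (j - large 1) c & (large 1 <= j)%N]))%:R
    = nu_count k.+1 h j.
  case: h => [|h]; first by rewrite nword_pred0 // nu_countS0.
  rewrite -(IH h j (ltnW kn)).1; congr (_%:R); apply: eq_nword => c.
  by rewrite /nu_free andbF /= subn0 andbT.
rewrite !nword_walksS !natrD !e1; split; last first.
  rewrite big1 ?addr0 // => v _; apply: nword_pred0 => c.
  by rewrite /nu_free /= ?andbF.
case: j e1 => [|j] _.
  rewrite big1 ?addr0 // => v _; apply: nword_pred0 => c.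
  by rewrite !andbF.
rewrite -[RHS](addrNK (nu_count k.+1 h j.+1)) -(@sum_nu_count n) // addrC.
congr (_ + _); rewrite natr_sum; apply: eq_bigr => v _.
rewrite -(IH (h + v)%N j (ltnW kn)).2; congr (_%:R); apply: eq_nword => c.
(* All large preceding parts impose the same condition, so 2 represents them. *)
rewrite (walks_prev _ _ _ 2) //; first by rewrite /nu_free /= subn1 andbT.
Qed.

(** After a 1 comes a large part. After a large part comes a large part, or a 1 that is last or
    followed by a large part: hence two terms. If that 1 is the appended one, it is counted by
    [o_count 0 0 0 = 1]. *)
Lemma nword_o n k h j : (k <= n)%N ->
  (nword n.+2 k (walks o_free (pred1 1%N) 1 h.+1 j))%:R = o_count k.+1 h.+1 j.+1
  /\ (nword n.+2 k (walks o_free (pred1 1%N) 2 h.+1 j))%:R =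
     o_count k.+1 h.+1 j.+1 + o_count k h j.
Proof.
elim: k h j => [|k IH] h j kn.
  rewrite !nword0 /walks /=; case: j => [|j]; rewrite ?andbF //=.
  by rewrite eqSS andbT add0r.
have e2 p : (\sum_(0 <= v < n) nword n.+2 k (fun c => [&& (0 < h.+1 + v)%N,
      o_free p v.+2, walks o_free (pred1 1%N) v.+2 (h.+1 + v) (j - pred1 1%N v.+2) c
      & (pred1 1%N v.+2 <= j)%N]))%:R = o_count k.+2 h.+1 j.+1.
  rewrite -(@sum_o_count n) // natr_sum; apply: eq_bigr => v _.
  rewrite -(IH (h + v)%N j (ltnW kn)).2; congr (_%:R); apply: eq_nword => c.
  by rewrite (walks_prev _ _ _ 2) // /o_free /= ?andbF subn0 andbT.
rewrite !nword_walksS !natrD !e2; split.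
  by rewrite nword_pred0 ?add0r // => c; rewrite /o_free /= ?andbF.
rewrite addrC; congr (_ + _).
case: j h {e2} => [|j] [|h]; rewrite ?o_countS0.
- by rewrite nword_pred0.
- by rewrite nword_pred0 // => c; rewrite !andbF.
- by rewrite nword_pred0.
rewrite -(IH h j (ltnW kn)).1; congr (_%:R); apply: eq_nword => c.
by rewrite /o_free /= subn1 andbT.
Qed.

Lemma nword_nu_dcomp n k j : (k.+1 < n)%N ->
  (nword n.+2 k.+1 (walks nu_free large 1 0 j.+1))%:R = nu_count k.+2 1 j.+1.
Proof.
case: n => // n; rewrite ltnS => kn; rewrite nword_walksS nword_pred0 // add0n.
(* A first part 2 would stay at height 0, so the sum starts at part 3 and becomes the one over large
   first parts from height 1. *)
rewrite big_ltn // nword_pred0 // add0n big_add1 succnK.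
have := @sum_nu_count n k 0 j kn; rewrite nu_countS0 subr0 => <-.
rewrite natr_sum.
apply: eq_bigr => v _; rewrite -(@nword_nu n.+1 k v j _).2; last by lia.
congr (_%:R); apply: eq_nword => c.
by rewrite (walks_prev _ _ _ 2) // /nu_free /= subn1 andbT.
Qed.

Lemma nword_o_dcomp n k j : (k.+1 < n)%N ->
  (nword n.+2 k.+1 (walks o_free (pred1 1%N) 1 0 j))%:R = o_count k.+2 1 j.+1.
Proof.
case: n => // n; rewrite ltnS => kn; rewrite nword_walksS nword_pred0 // add0n.
rewrite big_ltn // nword_pred0 // add0n big_add1 succnK.
rewrite -(@sum_o_count n) // natr_sum.
apply: eq_bigr => v _; rewrite -(@nword_o n.+1 k v j _).2; last by lia.
congr (_%:R); apply: eq_nword => c.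
by rewrite (walks_prev _ _ _ 2) // /o_free /= ?andbF subn0 andbT.
Qed.

Lemma walk_gt0 h c : walk h c -> all (leq 1) c.
Proof. by elim: c h => //= x c IH h /and3P[-> _ /IH]. Qed.

(** A walk from height 0 starts with a part at least 3, so the fictitious part 1 before it adds no
    constraint. *)
Lemma path_sorted_walk0 (e : rel nat) c : (forall v, e 1%N v.+2) -> walk 0 c ->
  path e 1 (rcons c 1%N) = sorted e (rcons c 1%N).
Proof. by case: c => [|[|[|x]] c] //= e1 _; rewrite e1. Qed.

Lemma count_large_ones c : all (leq 1) c ->
  (count large c + count (pred1 1%N) c = size c)%N.
Proof.
elim: c => //= x c IH /andP[x0 /IH <-]; rewrite /large.
by case: x x0 => [|[]]; lia.
Qed.

Lemma card_Dnu k j : (0 < k)%N -> (0 < j)%N ->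
  #|[set c in DComp k j | Dnu (parts c) == set0]|%:R = nu_count k.+1 1 j.
Proof.
case: k j => [|k] [|j] // _ _.
rewrite -(@nword_nu_dcomp (2 * k.+1)); last by lia.
congr (_%:R); rewrite -(addn2 (2 * k.+1)); apply: eq_card => c; rewrite !inE is_dcompE.
rewrite /Dnu (adjacent_set0 (fun x y => (1 < x) && (1 < y))%N) /walks.
rewrite size_map size_tuple eqxx /=.
by case: (boolP (walk 0 _)) => // wc; rewrite path_sorted_walk0 // andbC.
Qed.

Lemma card_Do k j : (0 < k)%N -> (j < k)%N ->
  #|[set c in DComp k (k - j) | Do (parts c) == set0]|%:R = o_count k.+1 1 j.+1.
Proof.
case: k => [|k] // _ jk.
rewrite -(@nword_o_dcomp (2 * k.+1)); last by lia.
congr (_%:R); rewrite -(addn2 (2 * k.+1)); apply: eq_card => c; rewrite !inE is_dcompE.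
have sc : size (parts c) = k.+1 by rewrite size_map size_tuple.
rewrite /Do (adjacent_set0 (fun x y => (x == 1) && (y == 1))%N) /walks sc eqxx /=.
case: (boolP (walk 0 _)) => // wc; rewrite path_sorted_walk0 // andbC.
(* Among k+1 positive parts, k+1-j are large exactly when j are ones. *)
congr (_ && _); have := count_large_ones _ (walk_gt0 _ _ wc); rewrite sc /large.
by move: (count _ _) (count _ _) => a b /=; lia.
Qed.

Theorem theorem4p9 (k : nat) (hk : (1 <= k)%N) :
  [/\ gamma_positive (narayana_poly k),
      narayana_poly k =
        \sum_(1 <= j < ((k + 1) %/ 2).+1)
          #|[set c in DComp k j | Dnu (parts c) == set0]|%:R
            *: ('X^j * (1 + 'X) ^+ (k + 1 - 2 * j))
    & forall j : nat, (1 <= j <= (k + 1) %/ 2)%N ->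
        #|[set c in DComp k j | Dnu (parts c) == set0]| =
        #|[set c in DComp k (k - j + 1) | Do (parts c) == set0]|].
Proof.
have expansion : narayana_poly k =
    \sum_(1 <= j < ((k + 1) %/ 2).+1)
      #|[set c in DComp k j | Dnu (parts c) == set0]|%:R
        *: ('X^j * (1 + 'X) ^+ (k + 1 - 2 * j)).
  rewrite narayana_poly_gamma //; apply: eq_big_nat => -[|j] // _.
  rewrite card_Dnu //; congr (_ *: _).
  case: k hk => [|k] // _; rewrite /nu_count /narayana_gamma subSS /= subSS subn0.
  by rewrite mul1r.
split=> //.
- exists (k + 1)%N.
  (* [gamma_positive] sums from index 0 and the expansion from 1, so the coefficient at 0 is set to
     0. *)
  exists (fun i => if i == 0%N then 0
    else #|[set c in DComp k i | Dnu (parts c) == set0]|%:R); split=> [i|].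
    by case: ifP => // _; exact: ler0n.
  rewrite big_ltn // scale0r add0r expansion.
  by apply: eq_big_nat => -[|j].
- move=> [|j] // /andP[_ jk]; apply/eqP; rewrite -(eqr_nat rat) card_Dnu //.
  rewrite (_ : k - j.+1 + 1 = k - j)%N; last by lia.
  rewrite card_Do //; last by lia.
  by case: k hk {expansion jk} => [|k] // _; rewrite nu_count1.
Qed.
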